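(* Let $\delta\in(0,n]$, $p\in[1,\infty)$ and $w\in\mathcal A_{p,\delta}$. Then there exist constants $K>0$ and $\gamma\in(0,1)$, depending only on $n,\delta,p$ and $[w]_{\mathcal A_{p,\delta}}$, such that for every cube $Q\subset\mathbb R^n$, $$\left[\frac1{\mathcal H^\delta_\infty(Q)}\int_Q w(x)^{1+\gamma}\,d\mathcal H^\delta_\infty\right]^{\frac1{1+\gamma}}\le\frac{K}{\mathcal H^\delta_\infty(Q)}\int_Q w(x)\,d\mathcal H^\delta_\infty.$$
   Context: A cube $Q\subset\mathbb R^n$ is a left-open right-closed cube with sides parallel to the axes; $l(Q)$ is its edge length. For $\delta\in(0,n]$ and $E\subset\mathbb R^n$, the Hausdorff content is $\mathcal H^\delta_\infty(E):=\inf\{\sum_i l(Q_i)^\delta:\ E\subset\bigcup_i Q_i\}$, the infimum over all finite or countable coverings of $E$ by cubes. For $E\subset\mathbb R^n$ and a non-negative function $g$ (no measurability required) the Choquet integral is $\int_E g\,d\mathcal H^\delta_\infty:=\int_0^\infty \mathcal H^\delta_\infty(\{x\in E: g(x)>t\})\,dt$. ''Almost everywhere'' with respect to $\mathcal H^\delta_\infty$ means outside a set of zero $\mathcal H^\delta_\infty$-content. A capacitary weight is a non-negative function $w$ with $\int_E w\,d\mathcal H^\delta_\infty<\infty$ for all compact $E$ and $w\in(0,\infty)$ $\mathcal H^\delta_\infty$-almost everywhere. For $p\in(1,\infty)$, $w\in\mathcal A_{p,\delta}$ means $w$ is a capacitary weight with $[w]_{\mathcal A_{p,\delta}}:=\sup_Q\{\frac1{\mathcal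 H^\delta_\infty(Q)}\int_Qw\,d\mathcal H^\delta_\infty\}\{\frac1{\mathcal H^\delta_\infty(Q)}\int_Qw^{-\frac1{p-1}}d\mathcal H^\delta_\infty\}^{p-1}<\infty$ (supremum over all cubes). $w\in\mathcal A_{1,\delta}$ means $w$ is a capacitary weight with $[w]_{\mathcal A_{1,\delta}}:=\inf\{K\in(0,\infty):\ \mathcal M_{\mathcal H^\delta_\infty}w\le Kw\ \ \mathcal H^\delta_\infty\text{-a.e.}\}<\infty$, where $\mathcal M_{\mathcal H^\delta_\infty}f(x):=\sup_{Q\ni x}\frac1{\mathcal H^\delta_\infty(Q)}\int_Q|f|\,d\mathcal H^\delta_\infty$, the supremum over all cubes containing $x$. *)

(* Defs.v *)
From HB Require Import structures.
From mathcomp Require Import all_boot all_order all_algebra.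
From mathcomp Require Import all_classical all_reals all_analysis.

Set Implicit Arguments.
Unset Strict Implicit.
Unset Printing Implicit Defensive.

Import Order.TTheory GRing.Theory Num.Theory.
Import numFieldNormedType.Exports.

Local Open Scope classical_set_scope.
Local Open Scope ring_scope.
Local Open Scope ereal_scope.

Section Cubes.
Context {R : realType} {n : nat}.

Record cube := Cube {
  corner : 'rV[R]_n;
  edge : R;
  edge_gt0 : (0 < edge)%R }.

Definition cube_set (Q : cube) : set 'rV[R]_n :=
  [set x | forall i : 'I_n,
    (corner Q 0%R i < x 0%R i <= corner Q 0%R i + edge Q)%R].

End Cubes.

Arguments cube : clear implicits.
Coercion cube_set : cube >-> set.

Section Content.
Context {R : realType} {n : nat}.
Implicit Types (delta p : R) (E : set 'rV[R]_n) (f g w : 'rV[R]_n -> \bar R).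

(* The index set I is an arbitrary (finite or infinite) set of naturals, so
   both finite and countable coverings are allowed. *)
Definition hausdorff_content delta E : \bar R :=
  ereal_inf [set s | exists (I : set nat) (Q : nat -> cube R n),
    E `<=` \bigcup_(i in I) (Q i : set _) /\
    s = \esum_(i in I) (edge (Q i) `^ delta)%:E].

Definition content_ae delta (P : 'rV[R]_n -> Prop) : Prop :=
  hausdorff_content delta [set x | ~ P x] = 0.

Definition choquet delta E g : \bar R :=
  \int[@lebesgue_measure R]_(t in `]0%R, +oo[)
    hausdorff_content delta [set x | E x /\ t%:E < g x].

Definition choquet_mean delta (Q : cube R n) g : \bar R :=
  choquet delta Q g / hausdorff_content delta Q.

Definition capacitary_maximal delta f (x : 'rV[R]_n) : \bar R :=
  ereal_sup [set choquet_mean delta Q (abse \o f) | Q in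
    [set Q : cube R n | (Q : set _) x]].

(* Weights are [0, +oo]-valued: finiteness is only required almost
   everywhere. *)
Definition capacitary_weight delta w : Prop :=
  [/\ forall x, 0 <= w x,
      forall E, compact E -> choquet delta E w < +oo &
      content_ae delta (fun x => 0 < w x < +oo)].

Definition A1_const delta w : \bar R :=
  ereal_inf [set K%:E | K in [set K : R | (0 < K)%R /\
    content_ae delta (fun x => capacitary_maximal delta w x <= K%:E * w x)]].

(* The negative power w^(-1/(p-1)) is written as the extended-real inverse of
   a positive power, so that 0 is sent to +oo and +oo to 0; the library's poweR
   with a negative exponent would send 0 to 0 and +oo to +oo. *)
Definition Ap_sup delta p w : \bar R :=
  ereal_sup [set choquet_mean delta Q w *
    choquet_mean delta Q (fun x => (w x `^ (p - 1)^-1)^-1) `^ (p - 1)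
    | Q in [set: cube R n]].

(* Meaningful for 1 <= p. *)
Definition Ap_const delta p w : \bar R :=
  if p == 1%R then A1_const delta w else Ap_sup delta p w.

Definition Ap_weight delta p w : Prop :=
  capacitary_weight delta w /\ Ap_const delta p w < +oo.

End Content.

(* Main.v *)
Require Import Defs.
From mathcomp Require Import all_boot all_order all_algebra.
From mathcomp Require Import all_classical all_reals all_analysis.
From mathcomp Require Import measurable_realfun ring lra.

Import Order.TTheory GRing.Theory Num.Theory.
Import numFieldNormedType.Exports.

Local Open Scope classical_set_scope.
Local Open Scope ring_scope.
Local Open Scope ereal_scope.

(** The proof rests on the distribution function [f s] of the weight on a cube
    [Q], the content of the points of [Q] where [w > s], and on its tails
    [I t], the integrals of [f] over the half-lines above [t].  Two facts drive
    it.

    First, a Muckenhoupt weight of mean [m] on a cube exceeds [alpha * m] on a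
    part of the cube that carries at least half of its content
    ([Ap_weight_half_above]).  For [p > 1] the points where [w] is small make
    the dual weight large, so Chebyshev's inequality bounds their content; for
    [p = 1] the maximal function is at least [m] on the whole cube, and
    exceeds a multiple of [w] only on a null set.

    Second, when [t] is at least the mean of [w] on [Q], the tail [I t] is at
    most a constant times [t * f (beta * t)], where [beta] is a fixed multiple
    of [alpha] ([tail_le_level]).  The Hausdorff content is not additive, so
    the integrals of [w] over disjoint stopping cubes may add up to much more
    than the integral over [Q].  Hence the argument starts from a cheap cover
    of the set [w > beta * t] and improves it.
    Its cubes are cut into dyadic subcubes of [Q], and each of these is
    enlarged to its smallest dyadic ancestor on which the mean of [w] is at
    most [t].  An ancestor that is a strict enlargement has a child of mean
    above [t], hence has mean at least [t / 2 ^ delta], so [w > beta * t] holds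
    on half of it; the original cubes that cover this half already paid for
    half of the ancestor.  The maximal ancestors therefore form a cover that
    costs at most twice as much ([stopping_cover]), and countable subadditivity
    bounds [I t] by the sum of the integrals of [w] over them, each at most
    [t] times the content of the cube.

    Since [f (beta * t)] is in turn controlled by the increment of the tail
    between [beta * t / 2] and [beta * t], tails at geometrically growing
    levels decay geometrically ([tail_geometric]).  The level sets thus decay
    slightly faster than the power [-1] of the level ([level_geometric]), and
    summing over the layers bounds the integral of [w ^ (1 + gamma)] for small
    [gamma] ([choquet_power_le]).

    The normalisation is that the content of a cube is exactly its edge to the
    power [delta] ([content_cube]), which reduces to comparing volumes
    ([cubes_volume]) because [delta <= n]. *)

(** * Countable sums, monotone functions and elementary estimates *)

Lemma esum_ge_term {R : realType} {T : choiceType} (I : set T) (a : T -> \bar R)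
    (i : T) : I i -> a i <= \esum_(j in I) a j.
Proof.
move=> Ii; apply: esum_ge; exists [set i]; last by rewrite fsbig_set1.
by split=> [|_ ->//]; exact: finite_set1.
Qed.

Lemma esum_subset {R : realType} {T : choiceType} (I J : set T) (a : T -> \bar R) :
  (forall i, J i -> 0 <= a i) -> I `<=` J ->
  \esum_(i in I) a i <= \esum_(i in J) a i.
Proof.
move=> a0 IJ; rewrite -(setIidr IJ) esum_mkcondr; apply: le_esum => i Ji.
by case: ifP => // _; exact: a0.
Qed.

Lemma le_esumZl {R : realType} {T : choiceType} (I : set T) (c : \bar R)
    (a : T -> \bar R) : 0 <= c -> (forall i, 0 <= a i) ->
  \esum_(i in I) (c * a i) <= c * \esum_(i in I) a i.
Proof.
move=> c0 a0; apply: ge_ereal_sup => _ [X XI <-].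
rewrite -ge0_mule_fsumr// lee_wpmul2l//; apply: esum_ge.
by exists X.
Qed.

(** The fibers [G i] are disjoint parts of [J], so no term of the sum over [J]
    is counted twice. *)
Lemma esum_le_fiber {R : realType} {T U : choiceType} (I : set T) (J : set U)
    (G : T -> set U) (a : U -> \bar R) : (forall j, 0 <= a j) ->
  (forall i, I i -> G i `<=` J) ->
  (forall i i' j, I i -> I i' -> G i j -> G i' j -> i = i') ->
  \esum_(i in I) \esum_(j in G i) a j <= \esum_(j in J) a j.
Proof.
move=> a0 GJ Gdisj; rewrite (esum_esum (a := fun=> a))//.
rewrite -(@esum_image _ _ _ (I `*`` G) snd a).
  by apply: esum_subset => // _ [[i j] [/= Ii Gij] <-]; exact: GJ Gij.
move=> [i j] [i' j']; rewrite !inE /= => -[Ii Gij] [Ii' Gij'] jj'.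
by rewrite -jj' in Gij' *; rewrite (Gdisj _ _ _ Ii Ii' Gij Gij').
Qed.

Lemma esum_setT_fin {R : realType} (T : finType) (a : T -> \bar R) :
  (forall i, 0 <= a i) -> \esum_(i in [set: T]) a i = \sum_i a i.
Proof.
move=> a0; rewrite esum_fset//; last exact: finite_finset.
apply: fsbig_fwiden => [i _||i [_ /(_ I)]//]; first by rewrite /= mem_index_enum.
exact: index_enum_uniq.
Qed.

(** Turns a sum over a set of indices into a series over all of them, the form
    in which monotone convergence is stated. *)
Lemma esum_nneseries {R : realType} (I : set nat) (a : nat -> \bar R) :
  (forall i, 0 <= a i) ->
  \esum_(i in I) a i = \sum_(i <oo) if i \in I then a i else 0.
Proof.
by move=> a0; rewrite esum_mkcond nneseries_esumT// => i; case: (i \in I).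
Qed.

Lemma integral_esum {d} {T : measurableType d} {R : realType}
    (mu : {measure set T -> \bar R}) (D : set T) (I : set nat)
    (f : nat -> T -> \bar R) :
  measurable D -> (forall i, measurable_fun D (f i)) ->
  (forall i x, 0 <= f i x) ->
  \int[mu]_(x in D) (\esum_(i in I) f i x) =
  \esum_(i in I) \int[mu]_(x in D) f i x.
Proof.
move=> mD mf f0.
under eq_integral do rewrite esum_nneseries//.
rewrite integral_nneseries//; last 2 first.
- by move=> i; case: (i \in I).
- by move=> i x _; case: (i \in I).
rewrite esum_nneseries => [|i]; last exact: integral_ge0.
apply: eq_eseriesr => i _.
by case: (i \in I) => //; rewrite integral0.
Qed.

Lemma measurable_esum {d} {T : measurableType d} {R : realType}
    (D : set T) (I : set nat) (f : nat -> T -> \bar R) :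
  measurable D -> (forall i, measurable_fun D (f i)) ->
  (forall i x, 0 <= f i x) ->
  measurable_fun D (fun x => \esum_(i in I) f i x).
Proof.
move=> mD mf f0.
under eq_fun do rewrite esum_nneseries//.
apply: (@ge0_emeasurable_sum _ _ _ _ _ xpredT) => [i x _ _|i _].
  by case: (i \in I).
by case: (i \in I) => //; exact: mf.
Qed.

Lemma nonincreasing_emeasurable {R : realType} (D : set R) (f : R -> \bar R) :
  measurable D -> (forall s t, (s <= t)%R -> f t <= f s) -> measurable_fun D f.
Proof.
move=> mD f_ni; apply: (measurability _ (ErealGenOInfty.measurableE R)) => //.
move=> _ [_ [r ->] <-]; apply: measurableI => //.
apply: is_interval_measurable => s t /=.
rewrite !in_itv/= !andbT => _ ft u /andP[_ ut].
by rewrite in_itv/= andbT (lt_le_trans ft)// f_ni.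
Qed.

Lemma nneseries_geometric_le {R : realType} (D r : R) :
  (0 <= D)%R -> (0 < r < 1)%R ->
  \sum_(k <oo) (D * r ^+ k)%:E <= (D / (1 - r))%:E.
Proof.
move=> D0 /andP[r0 r1]; apply: lime_le.
  by apply: is_cvg_nneseries => k *; rewrite lee_fin mulr_ge0// exprn_ge0// ltW.
apply: nearW => m; rewrite sumEFin lee_fin.
by apply: (geometric_le_lim m D0 r0); rewrite ger0_norm// ltW.
Qed.

Lemma exists_small_power {R : realType} (b e : R) : (1 < b)%R -> (1 < e)%R ->
  exists2 gamma : R, (0 < gamma < 1)%R & (b `^ gamma <= e)%R.
Proof.
move=> b1 e1; have lnb : (0 < ln b)%R by rewrite ln_gt0.
have lne : (0 < ln e)%R by rewrite ln_gt0.
have [b0 e0] : (0 < b)%R /\ (0 < e)%R by split; lra.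
exists (Num.min (2^-1) (ln e / ln b))%R.
  by rewrite lt_min gt_min divr_gt0// andbT; apply/andP; split; [|apply/orP; left]; lra.
rewrite -ler_ln ?posrE ?powR_gt0// ln_powR -ler_pdivlMr//.
by rewrite ge_min lexx orbT.
Qed.

(** * The Hausdorff content of cubes and of countable unions *)

(** Slicing by the hyperplanes that fix the last coordinate: each slice of the
    box is covered by the slices of the cubes that meet the hyperplane, and
    integrating the inequality for slices over the last coordinate gives the
    next dimension.  Points are sequences, of which the first [n] terms matter,
    so that a slice of a box is again of the same form. *)
Lemma cubes_volume {R : realType} (n : nat) (I : set nat) (a : nat -> R) (L : R)
    (c : nat -> nat -> R) (s : nat -> R) :
  (0 < L)%R -> (forall i, (0 < s i)%R) ->
  (forall x : nat -> R, (forall j, (j < n)%N -> (a j < x j <= a j + L)%R) ->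
    exists2 i, I i & forall j, (j < n)%N -> (c i j < x j <= c i j + s i)%R) ->
  (L ^+ n)%:E <= \esum_(i in I) (s i ^+ n)%:E.
Proof.
move=> L0 s0; elim: n I => [|n IHn] I cov.
  have [//|i Ii _] := cov a.
  by rewrite expr0; exact: (esum_ge_term I (fun i => (s i ^+ 0)%:E) i Ii).
pose J i : set R := [set` `]c i n, (c i n + s i)%R]].
pose f i (t : R) := (s i ^+ n)%:E * (\1_(J i) t)%:E.
have mf E i : measurable_fun E (f i).
  apply: emeasurable_funM => //; apply/measurable_EFinP.
  by apply: measurable_indic; exact: measurable_itv.
have f0 i t : 0 <= f i t.
  by rewrite /f -EFinM lee_fin mulr_ge0// exprn_ge0// ltW.
pose D : set R := [set` `]a n, (a n + L)%R]].
have intJ (b h : R) : (0 < h)%R ->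
    lebesgue_measure ([set` `]b, (b + h)%R]] : set R) = h%:E.
  by move=> h0; rewrite lebesgue_measure_itv/= lte_fin ltrDl h0 -EFinB addrC addKr.
have -> : (L ^+ n.+1)%:E = \int[lebesgue_measure]_(t in D) (L ^+ n)%:E.
  rewrite integral_cst; last exact: measurable_itv.
  by rewrite exprSr EFinM -(intJ (a n) L L0).
apply: (@le_trans _ _
    (\int[lebesgue_measure]_(t in D) (\esum_(i in I) f i t))).
  apply: ge0_le_integral => //.
  - exact: measurable_itv.
  - by move=> t _; rewrite lee_fin exprn_ge0// ltW.
  - apply: measurable_esum => //; [exact: measurable_itv|].
    by move=> i; exact: mf.
  move=> t; rewrite /D /= in_itv/= => tD.
  apply: (@le_trans _ _ (\esum_(i in I `&` [set i | J i t]) (s i ^+ n)%:E)).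
    apply: IHn => x xD.
    have [j|i Ii ix] := cov (fun j => if j == n then t else x j).
      rewrite ltnS leq_eqVlt; case: eqP => [->//|_]/= jn; exact: xD.
    exists i.
      by split=> //=; have := ix n; rewrite ltnSn eqxx /J/= in_itv/=; exact.
    move=> j jn; have := ix j; rewrite ltnS (ltnW jn) (ltn_eqF jn); exact.
  rewrite esum_mkcondr; apply: le_esum => i Ii.
  rewrite /f indicE; case: ifPn => [|_]; last first.
    by rewrite -EFinM lee_fin mulr_ge0// exprn_ge0// ltW.
  by rewrite inE /= => Jt; rewrite mem_set// mule1.
rewrite integral_esum//; [|exact: measurable_itv|by move=> i; exact: mf].
apply: le_esum => i Ii.
rewrite /f ge0_integralZl//; [|exact: measurable_itv| |]; last 2 first.
- by apply/measurable_EFinP/measurable_indic; exact: measurable_itv.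
- by rewrite lee_fin exprn_ge0// ltW.
rewrite exprSr EFinM lee_wpmul2l ?lee_fin ?exprn_ge0 ?(ltW (s0 i))//.
rewrite integral_indic; [|exact: measurable_itv|exact: measurable_itv].
rewrite -(intJ (c i n) (s i))//; apply: le_measure; rewrite ?inE.
- by apply: measurableI; exact: measurable_itv.
- exact: measurable_itv.
- by move=> x [].
Qed.

Section HausdorffContent.
Context {R : realType} {n : nat} {delta : R}.
Implicit Types (E F : set 'rV[R]_n) (Q : cube R n).
Local Notation H := (@hausdorff_content R n delta).

Lemma content_ge0 E : 0 <= H E.
Proof.
apply: le_ereal_inf_tmp => _ [I [Q [_ ->]]].
by apply: esum_ge0 => i _; rewrite lee_fin powR_ge0.
Qed.

Lemma content_le E F : E `<=` F -> H E <= H F.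
Proof.
move=> EF; apply: le_ereal_inf_tmp => _ [I [Q [FQ ->]]].
by apply: ereal_inf_lbound; exists I, Q; split=> //; exact: subset_trans FQ.
Qed.

(** The definition indexes covers by naturals; any countable index type will
    do, by renumbering along its enumeration. *)
Lemma content_cover (T : countType) (I : set T) (Q : T -> cube R n) E :
  E `<=` \bigcup_(i in I) Q i -> H E <= \esum_(i in I) (edge (Q i) `^ delta)%:E.
Proof.
move=> EQ; apply: ereal_inf_lbound.
pose Q' k := oapp Q (Cube 0%R (@ltr01 R)) (unpickle k).
have Q'E i : Q' (pickle i) = Q i by rewrite /Q' pickleK.
exists (pickle @` I), Q'; split.
  move=> x /EQ[i Ii Qix]; exists (pickle i); first by exists i.
  by rewrite Q'E.
rewrite esum_image; last by move=> i j _ _; apply: pcan_inj pickleK _ _.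
by apply: eq_esum => i _; rewrite Q'E.
Qed.

Lemma content_approx E (e : R) : (0 < e)%R -> H E < +oo ->
  exists (I : set nat) (Q : nat -> cube R n), E `<=` \bigcup_(i in I) Q i /\
    \esum_(i in I) (edge (Q i) `^ delta)%:E <= H E + e%:E.
Proof.
move=> e0 Efin.
have fin : H E \is a fin_num by rewrite ge0_fin_numE// content_ge0.
have [_ [I [Q [EQ ->]]] /ltW h] := lb_ereal_inf_adherent e0 fin.
by exists I, Q.
Qed.

(** Approximate the content of the [i]-th set within [e / 2 ^ (i + 1)], and put
    the countably many covers together. *)
Lemma content_bigcup (I : set nat) (E : nat -> set 'rV[R]_n) :
  H (\bigcup_(i in I) E i) <= \esum_(i in I) H (E i).
Proof.
have [[i [Ii Eoo]]|fin] := pselect (exists i, I i /\ H (E i) = +oo).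
  rewrite (_ : \esum_(i in I) _ = +oo) ?leey//; apply/eqP; rewrite -leye_eq -Eoo.
  exact: (esum_ge_term I (H \o E)).
apply/lee_addgt0Pr => e e0.
have approx i : exists JQ : set nat * (nat -> cube R n), I i ->
    E i `<=` \bigcup_(k in JQ.1) JQ.2 k /\
    \esum_(k in JQ.1) (edge (JQ.2 k) `^ delta)%:E
      <= H (E i) + (e / (2 ^ i.+1)%:R)%:E.
  have [Ii|nIi] := pselect (I i); last by exists (set0, fun=> Cube 0%R ltr01).
  have e2 : (0 < e / (2 ^ i.+1)%:R)%R by rewrite divr_gt0// ltr0n expn_gt0.
  have Efin : H (E i) < +oo by rewrite ltey; apply/eqP => ?; apply: fin; exists i.
  by have [J [Q JQ]] := content_approx (E i) _ e2 Efin; exists (J, Q).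
have [JQ JQP] := choice approx.
apply: (@le_trans _ _ (\esum_(k in I `*`` (fun i => (JQ i).1))
    (edge ((JQ k.1).2 k.2) `^ delta)%:E)).
  apply: content_cover => x [i Ii Eix].
  by have [k Jk Qk] := (JQP i Ii).1 _ Eix; exists (i, k).
rewrite -(esum_esum (a := fun i k => (edge ((JQ i).2 k) `^ delta)%:E)); last first.
  by move=> i k _ _; rewrite lee_fin powR_ge0.
apply: (@le_trans _ _ (\esum_(i in I) (H (E i) + (e / (2 ^ i.+1)%:R)%:E))).
  by apply: le_esum => i Ii; exact: (JQP i Ii).2.
have e2 i : (0 <= e / (2 ^ i.+1)%:R)%R by rewrite divr_ge0// ltW.
rewrite -[I]set_mem_set -!nneseries_esum.
- by apply: epsilon_trick; [move=> i; exact: content_ge0|exact: ltW].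
- by move=> i _; exact: content_ge0.
- by move=> i _; apply: adde_ge0; [exact: content_ge0|rewrite lee_fin].
Qed.

Lemma content_setU E F : H (E `|` F) <= H E + H F.
Proof.
rewrite -bigcup2E; apply: (le_trans (@content_bigcup setT _)).
rewrite -nneseries_esumT; last by move=> i; exact: content_ge0.
have H0 : H set0 = 0.
  apply/le_anti; rewrite content_ge0 andbT.
  rewrite -(@esum_set0 _ nat (fun=> (edge (Cube (0%R : 'rV[R]_n) ltr01) `^ delta)%:E)).
  exact: content_cover.
rewrite (nneseries_split 0 2) => [|k _]; last exact: content_ge0.
rewrite eseries0 ?adde0 => [|[|[|k]]//= _ _].
  by rewrite !big_nat_recr//= big_nil add0e.
Qed.

Context (delta_gt0 : (0 < delta)%R) (delta_len : (delta <= n%:R)%R).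

(** A cover by a cube at least as large as [Q] costs enough by itself.  Otherwise
    all the ratios of edges are at most [1], where the power [delta] dominates
    the power [n], and the volumes of the cubes add up to that of [Q]. *)
Lemma content_cube Q : H Q = (edge Q `^ delta)%:E.
Proof.
have LQ := edge_gt0 Q; apply/le_anti/andP; split.
  rewrite -(@esum_set1 _ nat 0%N (fun=> (edge Q `^ delta)%:E)) ?lee_fin ?powR_ge0//.
  by apply: content_cover => x Qx; exists 0%N.
apply: le_ereal_inf_tmp => _ [I [P [QP ->]]].
have [[i [Ii Qi]]|small] := pselect (exists i, I i /\ (edge Q <= edge (P i))%R).
  apply: le_trans (esum_ge_term I (fun i => (edge (P i) `^ delta)%:E) i Ii).
  rewrite lee_fin ge0_ler_powR// ?nnegrE ltW//.
  exact: edge_gt0.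
have lt1 i : I i -> (edge (P i) / edge Q <= 1)%R.
  move=> Ii; rewrite ler_pdivrMr// mul1r leNgt; apply/negP => /ltW h.
  by apply: small; exists i.
pose coord (x : 'rV[R]_n) j : R := if insub j is Some i then x 0%R i else 0%R.
have coordE (x : 'rV[R]_n) (i : 'I_n) : coord x i = x 0%R i.
  by rewrite /coord insubT//= => ?; congr (x _ _); exact: val_inj.
(* Rescaling by the edge of [Q] reduces to a box of edge 1. *)
have vol : 1 <= \esum_(i in I) ((edge (P i) / edge Q) `^ delta)%:E.
  apply: (@le_trans _ _ (\esum_(i in I) ((edge (P i) / edge Q) ^+ n)%:E)).
    rewrite -[1]/(1%:E) -(expr1n R n).
    apply: (@cubes_volume _ _ _ (fun j => coord (corner Q) j / edge Q)%R _
      (fun i j => coord (corner (P i)) j / edge Q)%R) => //.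
      by move=> i; rewrite divr_gt0// edge_gt0.
    move=> x xQ; have [|i Ii Pi] := QP (\row_(i < n) (edge Q * x i))%R.
      move=> i; rewrite mxE; have := xQ i (ltn_ord i); rewrite coordE.
      by rewrite ltr_pdivrMr// -[X in (_ <= _ + X)%R](divff (lt0r_neq0 LQ)) -mulrDl
        ler_pdivlMr// mulrC.
    exists i => // j jn; have := Pi (Ordinal jn); rewrite mxE -!coordE/=.
    by rewrite ltr_pdivrMr// -mulrDl ler_pdivlMr// mulrC.
  apply: le_esum => i Ii; rewrite lee_fin -powR_mulrn; last first.
    by rewrite divr_ge0// ltW// edge_gt0.
  by apply: ger_powR => //; rewrite divr_gt0 ?edge_gt0//=; exact: lt1.
rewrite (_ : \esum_(i in I) _ = (edge Q `^ delta)%:E *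
    \esum_(i in I) ((edge (P i) / edge Q) `^ delta)%:E).
  by rewrite -[leLHS]mule1 lee_wpmul2l// lee_fin powR_ge0.
rewrite -[I]set_mem_set -!nneseries_esum; last 2 first.
- by move=> i _; rewrite lee_fin powR_ge0.
- by move=> i _; rewrite lee_fin powR_ge0.
rewrite -nneseriesZl; last by move=> i _; rewrite lee_fin powR_ge0.
apply: eq_eseriesr => i _; rewrite -EFinM -powRM ?divr_ge0 ?(ltW (edge_gt0 _))//.
by rewrite mulrCA divff ?mulr1// gt_eqF.
Qed.

Lemma cube_content_gt0 Q : (0 < edge Q `^ delta)%R.
Proof. by rewrite powR_gt0// edge_gt0. Qed.

End HausdorffContent.

(** * Choquet integrals and their tails *)

Section ChoquetIntegral.
Context {R : realType} {n : nat} {delta : R}.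
Implicit Types (E F : set 'rV[R]_n) (g w : 'rV[R]_n -> \bar R).
Local Notation H := (@hausdorff_content R n delta).
Local Notation mu := (@lebesgue_measure R).

Definition level E g (t : R) : \bar R :=
  @hausdorff_content R n delta [set x | E x /\ t%:E < g x].

Definition tail E g (t : R) : \bar R :=
  \int[@lebesgue_measure R]_(s in `]t, +oo[) level E g s.

Lemma level_ge0 E g t : 0 <= level E g t.
Proof. exact: content_ge0. Qed.

Lemma level_nonincreasing E g s t : (s <= t)%R -> level E g t <= level E g s.
Proof.
move=> st; apply: content_le => x [Ex tg]; split=> //.
by apply: le_lt_trans tg; rewrite lee_fin.
Qed.

Lemma level_le_set E F g t : E `<=` F -> level E g t <= level F g t.
Proof. by move=> EF; apply: content_le => x [/EF]. Qed.

Lemma measurable_level E g (D : set R) : measurable D ->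
  measurable_fun D (level E g).
Proof. by move=> mD; apply: nonincreasing_emeasurable (level_nonincreasing E g). Qed.

Lemma tail0 E g : tail E g 0 = choquet delta E g.
Proof. by []. Qed.

Lemma tail_ge0 E g t : 0 <= tail E g t.
Proof. by apply: integral_ge0 => s _; exact: level_ge0. Qed.

Lemma choquet_ge0 E g : 0 <= choquet delta E g.
Proof. exact: tail_ge0. Qed.

Lemma choquet_le_set E F g : E `<=` F -> choquet delta E g <= choquet delta F g.
Proof.
move=> EF; apply: ge0_le_integral.
- exact: measurable_itv.
- by move=> s _; exact: level_ge0.
- by apply: measurable_level; exact: measurable_itv.
- by apply: measurable_level; exact: measurable_itv.
- by move=> s _; exact: level_le_set.
Qed.

(** On the interval from [t] to [v] the distribution function is at least its
    value at [v]. *)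
Lemma tail_split E g (t v : R) : (t <= v)%R ->
  (v - t)%:E * level E g v + tail E g v <= tail E g t.
Proof.
move=> tv; rewrite /tail (@itv_bndbnd_setU _ _ (BRight t) (BRight v) +oo%O)//.
have m (i : interval R) : measurable [set` i] by exact: measurable_itv.
rewrite ge0_integral_setU//.
- rewrite leeD2r//.
  rewrite muleC (_ : (v - t)%:E = mu [set` `]t, v]%R]); last first.
    rewrite lebesgue_measure_itv/= lte_fin; case: ltP => // vt.
    by rewrite (@le_anti _ _ v t) ?subrr// vt tv.
  rewrite -integral_cst//; apply: ge0_le_integral => //.
  + by move=> s _; exact: level_ge0.
  + by apply: measurable_level; exact: m.
  + by move=> s /=; rewrite in_itv/= => /andP[_ /level_nonincreasing]; exact.
- by apply: measurable_level; apply: measurableU; exact: m.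
- by move=> s _; exact: level_ge0.
- apply/eqP; rewrite -subset0 => s []/=; rewrite !in_itv/= andbT => -[/andP[_ sv]].
  by rewrite ltNge sv.
Qed.

Lemma tail_nonincreasing E g (t v : R) : (t <= v)%R -> tail E g v <= tail E g t.
Proof.
move=> tv; apply: le_trans (tail_split _ _ _ _ tv); rewrite leeDr//.
by rewrite mule_ge0 ?level_ge0// lee_fin subr_ge0.
Qed.

Lemma level_le_tail E g (t v : R) : (t <= v)%R ->
  (v - t)%:E * level E g v <= tail E g t.
Proof.
by move=> tv; apply: le_trans (tail_split _ _ _ _ tv); rewrite leeDl// tail_ge0.
Qed.

Lemma tail_le_cover E g (I : set nat) (P : nat -> set 'rV[R]_n) (t : R) :
  (0 <= t)%R -> [set x | E x /\ t%:E < g x] `<=` \bigcup_(i in I) P i ->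
  tail E g t <= \esum_(i in I) choquet delta (P i) g.
Proof.
move=> t0 EP.
have m : measurable ([set` `]t, +oo[%R] : set R) by exact: measurable_itv.
apply: (@le_trans _ _ (\int[mu]_(s in `]t, +oo[) \esum_(i in I) level (P i) g s)).
  apply: ge0_le_integral => //.
  - by move=> s _; exact: level_ge0.
  - exact: measurable_level.
  - apply: measurable_esum => // i; [exact: measurable_level|].
    by move=> s; exact: level_ge0.
  - move=> s /=; rewrite in_itv/= andbT => /ltW ts.
    apply: le_trans (content_bigcup _ _); apply: content_le => x [Ex sx].
    have [|i Ii Pix] := EP x; last by exists i.
    by split=> //; apply: le_lt_trans sx; rewrite lee_fin.
rewrite integral_esum//; last 2 first.
- by move=> i; exact: measurable_level.
- by move=> i s; exact: level_ge0.
by apply: le_esum => i _; exact: (tail_nonincreasing (P i) g 0 t t0).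
Qed.

(** Chebyshev's inequality, in a form that leaves the behaviour of [g] at the
    level [v] itself open. *)
Lemma choquet_ge E F g (v : R) : (0 <= v)%R ->
  (forall s : R, (0 < s < v)%R -> F `<=` [set x | E x /\ s%:E < g x]) ->
  v%:E * H F <= choquet delta E g.
Proof.
move=> v0 FE.
have m (i : interval R) : measurable ([set` i] : set R) by exact: measurable_itv.
rewrite -tail0 /tail; apply: (@le_trans _ _ (\int[mu]_(s in `]0%R, v[) level E g s)).
  rewrite muleC (_ : v%:E = mu [set` `]0%R, v[%R]); last first.
    rewrite lebesgue_measure_itv/= lte_fin sube0; case: ltP => // vt.
    by congr EFin; apply/le_anti; rewrite v0 vt.
  rewrite -integral_cst//; apply: ge0_le_integral => //.
  - by move=> s _; exact: content_ge0.
  - by apply: measurable_level; exact: m.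
  - by move=> s /=; rewrite in_itv/= => sv; exact/content_le/FE.
apply: ge0_subset_integral => //.
- by apply: measurable_level; exact: m.
- by move=> s _; exact: level_ge0.
- by move=> s /=; rewrite !in_itv/= andbT => /andP[].
Qed.

(** The layer-cake bound over the levels [T k], in any order: a level [t] lies
    below some [T k], and for the least such [k] it is at least [T (k - 1)]. *)
Lemma choquet_steps E g (T : nat -> R) (c : nat -> \bar R) :
  (forall k, (0 <= T k)%R) -> (forall t, exists k, (t < T k)%R) ->
  H E <= c 0%N -> (forall k, level E g (T k) <= c k.+1) ->
  choquet delta E g <= \sum_(k <oo) c k * (T k)%:E.
Proof.
move=> T0 Tlarge c0 cS.
have m (i : interval R) : measurable ([set` i] : set R) by exact: measurable_itv.
have c_ge0 k : 0 <= c k.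
  by case: k => [|k]; [apply: le_trans c0|apply: le_trans (cS k)]; exact: content_ge0.
pose S k (t : R) := c k * (\1_([set` `]0%R, T k[%R] : set R) t)%:E.
have S0 k t : 0 <= S k t by rewrite mule_ge0// lee_fin.
have mS k : measurable_fun (`]0%R, +oo[ : set R) (S k).
  apply: emeasurable_funM => //; apply/measurable_EFinP.
  by apply: measurable_indic; exact: m.
apply: (@le_trans _ _ (\int[mu]_(t in `]0%R, +oo[) \sum_(k <oo) S k t)).
  apply: ge0_le_integral => //.
  - by move=> s _; exact: level_ge0.
  - by apply: measurable_level; exact: m.
  - apply: (@ge0_emeasurable_sum _ _ _ _ _ xpredT) => [k x _ _|k _]; first exact: S0.
    exact: mS.
  - move=> t /=; rewrite in_itv/= andbT => t0.
    case: (ex_minnP (Tlarge t)) => k tk kmin.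
    apply: (@le_trans _ _ (S k t)).
      rewrite /S indicE mem_set/= ?in_itv/= ?t0// mule1.
      case: k tk kmin => [_ _|k tk kmin].
        by apply: le_trans c0; apply: content_le => x [].
      apply: le_trans (cS k); apply: level_nonincreasing.
      by rewrite leNgt; apply/negP => /kmin; rewrite ltnn.
    by rewrite nneseries_esumT//; exact: (esum_ge_term setT (S ^~ t)).
rewrite integral_nneseries//; apply: lee_nneseries => k *.
  by apply: integral_ge0 => t _; exact: S0.
rewrite /S ge0_integralZl//; last by apply/measurable_EFinP/measurable_indic; exact: m.
rewrite lee_wpmul2l// integral_indic; [|exact: m|exact: m].
apply: (@le_trans _ _ (mu [set` `]0%R, T k[%R])).
  by apply: le_measure; rewrite ?inE; [apply: measurableI; exact: m|exact: m|move=> x []].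
by rewrite lebesgue_measure_itv/= lte_fin sube0; case: ltP => // _; rewrite lee_fin.
Qed.

Lemma tail_le_countable_cover (T : countType) E g (I : set T)
    (P : T -> set 'rV[R]_n) (t : R) :
  (0 <= t)%R -> [set x | E x /\ t%:E < g x] `<=` \bigcup_(i in I) P i ->
  tail E g t <= \esum_(i in I) choquet delta (P i) g.
Proof.
move=> t0 EP; pose P' m := oapp P set0 (unpickle m).
have P'E i : P' (pickle i) = P i by rewrite /P' pickleK.
have := tail_le_cover E g (pickle @` I) P' t t0.
rewrite esum_image; last by move=> i j _ _; apply: pcan_inj pickleK _ _.
under eq_esum do rewrite P'E; apply => x /EP[i Ii Pix].
by exists (pickle i); [exists i|rewrite P'E].
Qed.

End ChoquetIntegral.

(** * Muckenhoupt weights are large on half of every cube *)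

Section Ainfty.
Context {R : realType} {n : nat} {delta : R}.
Context (delta_gt0 : (0 < delta)%R) (delta_len : (delta <= n%:R)%R).
Implicit Types (P : cube R n) (w : 'rV[R]_n -> \bar R).
Local Notation H := (@hausdorff_content R n delta).

(** The form in which the Muckenhoupt conditions for all [p] enter the reverse
    Hölder inequality; it plays the role of the classical [A_infinity]
    condition. *)
Definition half_above (alpha : R) w : Prop :=
  forall P (m : R), (0 < m)%R -> choquet delta P w = (m * edge P `^ delta)%:E ->
    (edge P `^ delta / 2)%:E <= @level R n delta P w (alpha * m).

Lemma choquet_mean_cube P w :
  choquet_mean delta P w = choquet delta P w * ((edge P `^ delta)^-1)%:E.
Proof.
by rewrite /choquet_mean content_cube// inver (negPf (lt0r_neq0 (cube_content_gt0 P))).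
Qed.

Lemma choquet_mean_fin P w (m : R) :
  choquet delta P w = (m * edge P `^ delta)%:E -> choquet_mean delta P w = m%:E.
Proof.
move=> wP; rewrite choquet_mean_cube wP -EFinM mulfK//.
exact/lt0r_neq0/cube_content_gt0.
Qed.

(** By subadditivity the parts of the cube below and above the level [t]
    together carry at least its whole content. *)
Lemma half_above_compl P w (t : R) :
  H [set x | cube_set P x /\ w x <= t%:E] <= (edge P `^ delta / 2)%:E ->
  (edge P `^ delta / 2)%:E <= @level R n delta P w t.
Proof.
move=> small; rewrite -(leeD2rE _ _ (_ : (edge P `^ delta / 2)%:E \is a fin_num))//.
rewrite -EFinD -splitr -content_cube//.
apply: le_trans (leeD2l _ small); apply: le_trans (content_setU _ _).
apply: content_le => x Px; case: (leP (w x) t%:E) => wt; [right|left]; by split.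
Qed.

(** The maximal function is at least the mean [m] at each point of the cube, so
    [w <= alpha * m] would violate the [A_1] inequality there: such points form
    a null set. *)
Lemma A1_half_above w (A : R) : capacitary_weight delta w ->
  A1_const delta w = A%:E -> half_above (2 * (`|A| + 1))^-1 w.
Proof.
move=> [w0 _ _] wA P m m0 wP.
have fin : A1_const delta w \is a fin_num by rewrite wA.
have [_ [K [K0 aeK] <-]] := lb_ereal_inf_adherent ltr01 fin.
rewrite -/(A1_const delta w) wA -EFinD lte_fin => KA.
apply: half_above_compl; rewrite (@le_trans _ _ 0)//; last first.
  by rewrite lee_fin divr_ge0// powR_ge0.
rewrite -aeK; apply: content_le => x [Px wx] Mw.
have mM : m%:E <= capacitary_maximal delta w x.
  apply: ereal_sup_ubound; exists P => //.
  rewrite (_ : abse \o w = w); first exact: choquet_mean_fin.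
  by apply/funext => y /=; rewrite gee0_abs.
have := le_trans mM Mw; apply/negP; rewrite -ltNge.
apply: (@le_lt_trans _ _ (K * ((2 * (`|A| + 1))^-1 * m))%:E).
  by rewrite EFinM lee_wpmul2l// lee_fin ltW.
have A1 : (0 < `|A| + 1)%R by rewrite ltr_wpDl.
rewrite lte_fin mulrA gtr_pMl// ltr_pdivrMr ?mulr_gt0// mul1r.
by have := ler_norm A; lra.
Qed.

(** Where [w <= a * m], the dual weight [w ^ (-1 / (p - 1))] is at least the
    number [v] below.  If this happened on more than half of the cube, the mean
    of the dual weight would be at least [v / 2], and the product in the [A_p]
    condition would be at least [`|A| + 1], by the choice of [a]. *)
Lemma Ap_half_above w (p A : R) : (1 < p)%R -> capacitary_weight delta w ->
  Ap_sup delta p w = A%:E -> half_above (2^-1 `^ (p - 1) / (`|A| + 1)) w.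
Proof.
move=> p1 [w0 _ _] wA P m m0 wP.
have A1 : (0 < `|A| + 1)%R by rewrite ltr_wpDl.
have p10 : (0 < p - 1)%R by rewrite subr_gt0.
set a := (2^-1 `^ (p - 1) / (`|A| + 1))%R.
have a0 : (0 < a)%R by rewrite divr_gt0// powR_gt0.
have am : (0 < a * m)%R by rewrite mulr_gt0.
have h0 := cube_content_gt0 (delta := delta) P.
set q := (p - 1)^-1%R; have q0 : (0 < q)%R by rewrite invr_gt0.
apply: half_above_compl; rewrite leNgt; apply/negP => big.
set E := [set x | _] in big.
set v := (((a * m) `^ q)^-1)%R.
have v0 : (0 < v)%R by rewrite invr_gt0 powR_gt0.
have cheb : v%:E * H E <= choquet delta P (fun x => (w x `^ q)^-1).
  apply: choquet_ge; first exact: ltW.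
  move=> s /andP[_ sv] x [Px wx]; split=> //.
  have wfin : w x \is a fin_num by rewrite ge0_fin_numE// (le_lt_trans wx) ?ltry.
  rewrite -(fineK wfin) poweR_EFin inver.
  have [//|nz] := eqVneq (fine (w x) `^ q)%R 0%R; first by rewrite ltry.
  have w_ge0 : (0 <= fine (w x))%R by rewrite fine_ge0.
  have wq0 : (0 < fine (w x) `^ q)%R by rewrite lt_neqAle eq_sym nz powR_ge0.
  rewrite lte_fin (lt_le_trans sv)// lef_pV2 ?posrE//; last exact: powR_gt0.
  apply: ge0_ler_powR; rewrite ?nnegrE ?(ltW q0) ?(ltW am)//.
  by rewrite -lee_fin fineK.
have mean : (v / 2)%:E <= choquet_mean delta P (fun x => (w x `^ q)^-1).
  rewrite choquet_mean_cube.
  apply: (@le_trans _ _ (v%:E * H E * ((edge P `^ delta)^-1)%:E)); last first.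
    by rewrite lee_wpmul2r// lee_fin invr_ge0 ltW.
  apply: (@le_trans _ _ (v%:E * (edge P `^ delta / 2)%:E * ((edge P `^ delta)^-1)%:E)).
    by rewrite -!EFinM lee_fin -mulrA (mulrAC _ 2^-1%R) divff ?mul1r// gt_eqF.
  by rewrite lee_wpmul2r ?lee_fin ?invr_ge0 ?(ltW h0)// lee_wpmul2l ?lee_fin ?ltW.
have : Ap_sup delta p w <= A%:E by rewrite wA.
apply/negP; rewrite -ltNge; apply: (@lt_le_trans _ _ (m%:E * (v / 2)%:E `^ (p - 1))).
  rewrite poweR_EFin -EFinM lte_fin.
  rewrite powRM ?invr_ge0 ?powR_ge0//.
  have -> : (v `^ (p - 1) = (a * m)^-1)%R.
    by rewrite /v -powRN -powRrM mulNr mulVf ?gt_eqF// powRN powRr1// ltW.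
  have b0 : (0 < 2^-1 `^ (p - 1) :> R)%R by rewrite powR_gt0.
  rewrite (_ : _ * _ = `|A| + 1)%R; last first.
    by rewrite /a; field; rewrite !gt_eqF.
  by rewrite (le_lt_trans (ler_norm A))// ltrDl.
apply: (@le_trans _ _ (m%:E *
    choquet_mean delta P (fun x => (w x `^ q)^-1) `^ (p - 1))).
  rewrite lee_wpmul2l ?lee_fin ?(ltW m0)//.
  have v2 : 0 <= (v / 2)%:E by rewrite lee_fin divr_ge0// ltW.
  apply: gt0_ler_poweR; rewrite ?in_itv/= ?andbT ?leey ?(le_trans v2 mean) ?v2 ?(ltW p10)//.
rewrite -(choquet_mean_fin _ _ _ wP).
by apply: ereal_sup_ubound; exists P.
Qed.

End Ainfty.

Lemma Ap_weight_half_above (R : realType) (n : nat) (delta p A : R) :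
  (0 < delta)%R -> (delta <= n%:R)%R -> (1 <= p)%R ->
  exists2 alpha : R, (0 < alpha <= 1)%R &
    forall w : 'rV[R]_n -> \bar R, Ap_weight delta p w ->
      Ap_const delta p w = A%:E -> half_above (delta := delta) alpha w.
Proof.
move=> d0 dn; rewrite le_eqVlt => /predU1P[<-|p1].
  exists (2 * (`|A| + 1))^-1%R.
    have := normr_ge0 A => A0; rewrite invr_gt0 invf_le1; lra.
  by move=> w [wcap _]; rewrite /Ap_const eqxx; exact: A1_half_above.
have A1 : (0 < `|A| + 1)%R by rewrite ltr_wpDl.
exists (2^-1 `^ (p - 1) / (`|A| + 1))%R.
  rewrite divr_gt0 ?powR_gt0//= ler_pdivrMr// mul1r.
  apply: (@le_trans _ _ 1%R); last by rewrite lerDr.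
  rewrite -[leRHS](powRr0 (2^-1 : R)) ger_powR ?ltW ?subr_gt0//; lra.
by move=> w [wcap _]; rewrite /Ap_const gt_eqF//; exact: Ap_half_above.
Qed.

(** * Dyadic subcubes of a cube *)

Section DyadicCubes.
Context {R : realType} {n : nat} (Q : cube R n).
Local Notation l := (edge Q).

(** The rank of the dyadic cube of generation [k] that contains [x], in each
    direction.  Cubes are left-open and right-closed, hence the ceiling; the
    grid covers the whole space, and [Q] is the cube of generation [0] with all
    ranks equal to [1]. *)
Definition dyadic_index (k : nat) (x : 'rV[R]_n) : {ffun 'I_n -> int} :=
  [ffun i => Num.ceil ((x 0%R i - corner Q 0%R i) / l * 2 ^+ k)%R].

Lemma dyadic_edge_gt0 (k : nat) : (0 < l / 2 ^+ k)%R.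
Proof. by rewrite divr_gt0 ?exprn_gt0// edge_gt0. Qed.

Definition dyadic_cube (k : nat) (m : {ffun 'I_n -> int}) : cube R n :=
  Cube (\row_i (corner Q 0%R i + l / 2 ^+ k * ((m i)%:~R - 1)))%R
    (dyadic_edge_gt0 k).

Definition cell (k : nat) (x : 'rV[R]_n) := dyadic_cube k (dyadic_index k x).

Lemma dyadic_cubeP k m x : cube_set (dyadic_cube k m) x <-> dyadic_index k x = m.
Proof.
have e0 := dyadic_edge_gt0 k; have l0 := edge_gt0 Q.
have p0 : (0 < 2 ^+ k :> R)%R by rewrite exprn_gt0.
have coord i : ((dyadic_cube k m).(corner) 0 i < x 0 i
      <= (dyadic_cube k m).(corner) 0 i + (dyadic_cube k m).(edge))%R =
    (Num.ceil ((x 0 i - corner Q 0 i) / l * 2 ^+ k) == m i)%R.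
  rewrite ceil_eq /= mxE intrB.
  have -> : ((x 0 i - corner Q 0 i) / l * 2 ^+ k
      = (x 0 i - corner Q 0 i) / (l / 2 ^+ k))%R.
    by rewrite invf_div mulrA mulrAC.
  rewrite ltr_pdivlMr// ler_pdivrMr//.
  by congr andb; apply/idP/idP => ?; lra.
split=> [xm|xm i]; last by have := coord i; rewrite -[in RHS]xm ffunE eqxx; exact.
by apply/ffunP => i; rewrite ffunE; apply/eqP; rewrite -coord.
Qed.

Lemma mem_cell k x y : cube_set (cell k x) y <-> dyadic_index k y = dyadic_index k x.
Proof. exact: dyadic_cubeP. Qed.

(** The parent of a dyadic interval depends on the interval only. *)
Lemma ceil_half (u v : R) :
  Num.ceil (u * 2)%R = Num.ceil (v * 2)%R -> Num.ceil u = Num.ceil v.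
Proof.
move=> uv; apply/esym/ceil_def.
have /andP[u1 u2] := ceil_itv u.
have /andP[v1 v2] := ceil_itv (v * 2)%R.
set a := Num.ceil u in u1 u2 *; set b := Num.ceil (v * 2)%R in uv v1 v2.
have b1 : (b <= a * 2)%R.
  by rewrite -uv ceil_le_int intrM ler_pM2r.
have b2 : (a * 2 - 1 <= b)%R.
  have : (a * 2 - 2 < b)%R.
    by rewrite -uv ceil_gt_int; move: u1; rewrite !intrB intrM; lra.
  by rewrite -ltzD1; lra.
move: b1 b2 v1 v2; rewrite -!(ler_int R) !intrB intrM => *.
by apply/andP; split; lra.
Qed.

Lemma dyadic_index_coarsen j k x y : (j <= k)%N ->
  dyadic_index k x = dyadic_index k y -> dyadic_index j x = dyadic_index j y.
Proof.
elim: k => [|k IHk]; first by rewrite leqn0 => /eqP ->.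
rewrite leq_eqVlt => /predU1P[->//|]; rewrite ltnS => jk xy; apply: IHk => //.
apply/ffunP => i; have /ffunP/(_ i) := xy.
by rewrite !ffunE !exprSr !mulrA => /ceil_half.
Qed.

Lemma mem_root x : cube_set Q x <-> dyadic_index 0 x = [ffun=> 1%R].
Proof.
have l0 := edge_gt0 Q.
have coord i : (corner Q 0 i < x 0 i <= corner Q 0 i + l)%R =
    (Num.ceil ((x 0 i - corner Q 0 i) / l * 2 ^+ 0) == 1)%R.
  rewrite ceil_eq subrr expr0 mulr1 mulr0z mulr1z.
  by rewrite ltr_pdivlMr// ler_pdivrMr// mul0r mul1r lerBlDl subr_gt0.
split=> [xQ|x1 i]; first by apply/ffunP => i; rewrite !ffunE; apply/eqP; rewrite -coord.
by rewrite coord; have /ffunP/(_ i) := x1; rewrite !ffunE => ->.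
Qed.

End DyadicCubes.

(** * Covers by dyadic cubes of controlled mean *)

Section DyadicCovers.
Context {R : realType} {n : nat} (Q : cube R n).
Local Notation l := (edge Q).

Lemma cell_refl k x : cube_set (cell Q k x) x.
Proof. exact/mem_cell. Qed.

Lemma cell_sub j k x : (j <= k)%N -> cube_set (cell Q k x) `<=` cell Q j x.
Proof. by move=> jk y /mem_cell xy; apply/mem_cell/(dyadic_index_coarsen _ _ _ _ _ jk). Qed.

Lemma cell0 x : cube_set Q x -> cube_set (cell Q 0 x) = Q.
Proof.
move=> /mem_root Qx; apply/seteqP; split=> y.
  by move=> /mem_cell xy; apply/mem_root; rewrite xy.
by move=> /mem_root Qy; apply/mem_cell; rewrite Qy.
Qed.

(** The generation of dyadic cubes by which a cube of edge [s] is covered.  The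
    alternative [k = 0] is for cubes larger than [Q], for which [Q] itself is
    enough. *)
Lemma comparable_scale (s : R) : (0 < s)%R ->
  exists k, (l / 2 ^+ k <= 2 * s)%R /\ (k = 0%N \/ (s <= l / 2 ^+ k)%R).
Proof.
move=> s0; have l0 := edge_gt0 Q.
have small : exists k, (l / 2 ^+ k <= 2 * s)%R.
  have lk := archi_boundP (divr_ge0 (ltW l0) (ltW s0)).
  set k := Num.bound _ in lk.
  exists k; rewrite ler_pdivrMr ?exprn_gt0//.
  move: lk; rewrite ltr_pdivrMr// => /ltW/le_trans; apply.
  rewrite mulrAC ler_pM2r//.
  have : (k%:R <= 2 ^+ k :> R)%R by rewrite -natrX ler_nat ltnW// ltn_expl.
  by have : (0 <= 2 ^+ k :> R)%R by []; lra.
case: (ex_minnP small) => -[|k] kl kmin; first by exists 0%N; split=> //; left.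
exists k.+1; split=> //; right.
have : (2 * s < l / 2 ^+ k)%R by rewrite ltNge; apply/negP => /kmin; rewrite ltnn.
move=> h; rewrite exprSr invfM mulrA ler_pdivlMr//; lra.
Qed.

(** In each direction the projection of [P] has length at most one step of the
    grid, so it meets at most two consecutive grid intervals.  A point of [P]
    thus has its dyadic cube determined by [n] bits: whether its rank in each
    direction is the lower of the two. *)
Lemma meets_two_cells k (P : cube R n) x y : (edge P <= l / 2 ^+ k)%R ->
  cube_set P x -> cube_set P y ->
  let b i := (Num.floor ((corner P 0 i - corner Q 0 i) / l * 2 ^+ k) + 1)%R in
  (forall i, (dyadic_index Q k x i != b i) = (dyadic_index Q k y i != b i)) ->
  dyadic_index Q k x = dyadic_index Q k y.
Proof.
move=> Pl Px Py b xy; apply/ffunP => i; have := xy i.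
have step z : cube_set P z ->
    dyadic_index Q k z i = b i \/ dyadic_index Q k z i = (b i + 1)%R.
  move=> /(_ i) /andP[z1 z2]; rewrite ffunE /b.
  have l0 := edge_gt0 Q; have p0 : (0 < 2 ^+ k :> R)%R by rewrite exprn_gt0.
  set u := ((z 0 i - _) / l * _)%R; set v := ((corner P 0 i - _) / l * _)%R.
  have vu : (v < u)%R by rewrite /u /v ltr_pM2r// ltr_pM2r ?invr_gt0// ltrD2r.
  have uv : (u <= v + 1)%R.
    rewrite /u /v -lerBlDl -mulrBl -mulrBl.
    have -> : (z 0 i - corner Q 0 i - (corner P 0 i - corner Q 0 i)
      = z 0 i - corner P 0 i)%R by ring.
    rewrite mulrAC ler_pdivrMr// mul1r -ler_pdivlMr//.
    by apply: le_trans Pl; rewrite lerBlDl.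
  have /andP[f1 f2] := floor_itv v; have /andP[c1 c2] := ceil_itv u.
  set a := Num.floor v in f1 f2 *; set c := Num.ceil u in c1 c2 *.
  have ac : (a < c)%R by rewrite ceil_gt_int; lra.
  have ca : (c <= a + 2)%R.
    by rewrite ceil_le_int intrD; move: f2; rewrite intrD; lra.
  have [->|cn] := eqVneq c (a + 1)%R; [by left|right].
  apply/le_anti/andP; split; first by rewrite -addrA.
  by rewrite lezD1 lt_neqAle eq_sym cn lezD1.
have bb : (b i + 1 != b i)%R by rewrite -subr_eq0 addrC addKr.
by case: (step x Px) => ->; case: (step y Py) => ->; rewrite ?eqxx ?bb.
Qed.

(** Each cube of the cover is replaced by the at most [2 ^ n] dyadic cubes of
    comparable size that meet it inside [E]; they are indexed by the bits of the
    previous lemma, and represented by points of [E]. *)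
Lemma dyadic_cover (delta : R) (E : set 'rV[R]_n) (I : set nat)
    (P : nat -> cube R n) : (0 <= delta)%R ->
  E `<=` Q -> E `<=` \bigcup_(i in I) P i ->
  exists (T : countType) (J : set T) (k : T -> nat) (x : T -> 'rV[R]_n),
  [/\ forall j, J j -> E (x j), E `<=` \bigcup_(j in J) cell Q (k j) (x j) &
    \esum_(j in J) (edge (cell Q (k j) (x j)) `^ delta)%:E <=
    (2 ^+ n * 2 `^ delta)%:E * \esum_(i in I) (edge (P i) `^ delta)%:E].
Proof.
move=> d0 EQ EP.
have [k kP] := choice (fun i => comparable_scale _ (edge_gt0 (P i))).
pose b i j := (Num.floor ((corner (P i) 0 j - corner Q 0 j) / l * 2 ^+ k i) + 1)%R.
pose sig i z : {ffun 'I_n -> bool} := [ffun j => dyadic_index Q (k i) z j != b i j].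
pose J : set (nat * {ffun 'I_n -> bool}) :=
  [set a | I a.1 /\ exists z, [/\ E z, cube_set (P a.1) z & sig a.1 z = a.2]].
have [x xP] : {x : nat * {ffun 'I_n -> bool} -> 'rV[R]_n & forall a, J a ->
    [/\ E (x a), cube_set (P a.1) (x a) & sig a.1 (x a) = a.2]}.
  apply: (@choice _ _ (fun a z => J a -> [/\ E z, cube_set (P a.1) z & sig a.1 z = a.2])).
  move=> a; have [[_ [z za]]|nJ] := pselect (J a); first by exists z.
  by exists 0%R.
exists (nat * {ffun 'I_n -> bool})%type, J, (fun a => k a.1), x; split.
- by move=> a /xP[].
- move=> z Ez; have [i Ii Piz] := EP z Ez.
  have Ja : J (i, sig i z) by split=> //; exists z.
  exists (i, sig i z) => //; apply/mem_cell => /=.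
  have [Ex Px sx] := xP _ Ja.
  case: (kP i) => _ [k0|kl].
    have /mem_root Qz := EQ _ Ez; have /mem_root Qx := EQ _ Ex.
    by rewrite k0 Qz Qx.
  apply: (meets_two_cells (k i) (P i)) => // j.
  by have /ffunP/(_ j) := sx; rewrite /= !ffunE => ->.
have c0 : (0 <= 2 `^ delta :> R)%R by exact: powR_ge0.
apply: (@le_trans _ _ (\esum_(a in I `*`` (fun=> [set: {ffun 'I_n -> bool}]))
    (2 `^ delta * edge (P a.1) `^ delta)%:E)).
  apply: (@le_trans _ _ (\esum_(a in J) (2 `^ delta * edge (P a.1) `^ delta)%:E)).
    apply: le_esum => a [Ia _]; rewrite lee_fin -powRM ?(ltW (edge_gt0 _))//.
    apply: ge0_ler_powR; rewrite ?nnegrE//.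
    - exact/ltW/dyadic_edge_gt0.
    - by rewrite mulr_ge0// ltW// edge_gt0.
    - by have [] := kP a.1.
  by apply: esum_subset => [a _|a [Ia _]]//; rewrite lee_fin mulr_ge0 ?powR_ge0.
rewrite -(esum_esum (a := fun i _ => (2 `^ delta * edge (P i) `^ delta)%:E)); last first.
  by move=> i s _ _; rewrite lee_fin mulr_ge0 ?powR_ge0.
apply: le_trans (le_esumZl _ _ _ _ _) => [||i]; last 2 first.
- by rewrite lee_fin mulr_ge0 ?exprn_ge0.
- by rewrite lee_fin powR_ge0.
apply: le_esum => i _; rewrite esum_setT_fin => [|a].
  rewrite sumEFin sumr_const card_ffun card_bool card_ord -EFinM lee_fin.
  by rewrite -[leLHS]mulr_natl natrX mulrA.
by rewrite lee_fin mulr_ge0 ?powR_ge0.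
Qed.

(** A dyadic cover of the set [E] where [w > beta * t], with
    [beta = alpha / 2 ^ delta], is improved to one by cubes on which [w] has
    mean at most [t], at twice the cost.  Each cube is enlarged to its smallest
    ancestor of mean at most [t], which exists since [Q] is one, and the maximal
    ancestors are kept.  If such an ancestor is a strict enlargement, one of its
    children has mean above [t], and monotonicity of the integral gives the
    ancestor a mean of at least [t / 2 ^ delta]; so [E] fills half of it.  By
    maximality this half is covered by the original cubes inside the ancestor,
    and the ancestors, being disjoint, share none of these. *)
Lemma stopping_cover (delta alpha t : R) (w : 'rV[R]_n -> \bar R)
    (T : countType) (J : set T) (k : T -> nat) (x : T -> 'rV[R]_n) :
  (0 < delta)%R -> (delta <= n%:R)%R ->
  (0 < alpha)%R -> half_above (delta := delta) alpha w ->
  (0 < t)%R -> choquet delta Q w <= (t * l `^ delta)%:E ->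
  let E := [set y | cube_set Q y /\ (alpha / 2 `^ delta * t)%:E < w y] in
  (forall j, J j -> E (x j)) -> E `<=` \bigcup_(j in J) cell Q (k j) (x j) ->
  exists (I : set (nat * {ffun 'I_n -> int})),
  [/\ E `<=` \bigcup_(s in I) dyadic_cube Q s.1 s.2,
      forall s, I s -> choquet delta (dyadic_cube Q s.1 s.2) w
        <= (t * edge (dyadic_cube Q s.1 s.2) `^ delta)%:E &
      \esum_(s in I) (edge (dyadic_cube Q s.1 s.2) `^ delta)%:E <=
      2%:E * \esum_(j in J) (edge (cell Q (k j) (x j)) `^ delta)%:E].
Proof.
move=> d0 dn a0 half t0 Qt E xE cov.
(* [kk j] is the generation of the smallest good ancestor of the cube [j]. *)
pose good j y := choquet delta (cell Q j y) w <= (t * edge (cell Q j y) `^ delta)%:E.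
have [kk kkP] : {kk : T -> nat & forall j, J j ->
    [/\ (kk j <= k j)%N, good (kk j) (x j) &
      kk j = k j \/ ~ good (kk j).+1 (x j)]}.
  apply: (@choice _ _ (fun j m => J j -> [/\ (m <= k j)%N, good m (x j) &
      m = k j \/ ~ good m.+1 (x j)])) => j.
  have [Jj|nJj] := pselect (J j); last by exists 0%N.
  pose p m := (m <= k j)%N && `[< good m (x j) >].
  have p0 : exists m, p m.
    exists 0%N; apply/asboolP; rewrite /good (cell0 _ (xE _ Jj).1)/=.
    by rewrite expr0 divr1.
  have pk m : p m -> (m <= k j)%N by case/andP.
  case: (ex_maxnP p0 pk) => m /andP[mk /asboolP gm] mmax.
  exists m => _; split=> //.
  have [->|mk'] := eqVneq m (k j); [by left|right => gS].
  have /mmax : p m.+1 by rewrite /p ltn_neqAle mk' mk; exact/asboolP.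
  by rewrite ltnn.
pose dc (s : nat * {ffun 'I_n -> int}) := dyadic_cube Q s.1 s.2.
pose S : set (nat * {ffun 'I_n -> int}) :=
  [set (kk j, dyadic_index Q (kk j) (x j)) | j in J].
(* The maximal ancestors; two of them that meet have the same generation. *)
pose M := [set s | S s /\ forall s' z, S s' ->
  cube_set (dc s) z -> cube_set (dc s') z -> (s.1 <= s'.1)%N].
have M_disj s s' z : M s -> M s' -> cube_set (dc s) z -> cube_set (dc s') z -> s = s'.
  move=> [Ss smax] [Ss' smax'] sz s'z.
  have e1 : s.1 = s'.1 by apply/eqP; rewrite eqn_leq (smax s' z)// (smax' s z).
  move/dyadic_cubeP : sz; move/dyadic_cubeP : s'z.
  by rewrite -e1 => -> e2; rewrite [s]surjective_pairing [s']surjective_pairing e1 e2.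
pose G s := [set j | J j /\ cube_set (dc s) (x j)].
exists M; split.
- move=> y Ey; have [j Jj yj] := cov y Ey.
  have ex : exists r, `[< exists s, [/\ S s, s.1 = r & cube_set (dc s) y] >].
    exists (kk j); apply/asboolP; exists (kk j, dyadic_index Q (kk j) (x j)).
    by split=> //; [exists j|apply: cell_sub yj; have [] := kkP j Jj].
  case: (ex_minnP ex) => r /asboolP[s [Ss sr sy]] rmin.
  exists s => //; split=> // s' z Ss' sz s'z; rewrite leqNgt; apply/negP => lt.
  suff /rmin : `[< exists s0, [/\ S s0, s0.1 = s'.1 & cube_set (dc s0) y] >].
    by rewrite -sr leqNgt lt.
  apply/asboolP; exists s'; split=> //.
  move/dyadic_cubeP : sz => sz; move/dyadic_cubeP : sy => sy.
  apply/dyadic_cubeP; move/dyadic_cubeP : s'z => <-.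
  by apply: (dyadic_index_coarsen _ _ _ _ _ (ltnW lt)); rewrite sy sz.
- by move=> s [[j Jj <-] _]; have [_ gj _] := kkP j Jj.
(* The original cubes inside [s] pay for half of [s]. *)
have key s : M s -> (edge (dc s) `^ delta)%:E <=
    2%:E * \esum_(j in G s) (edge (cell Q (k j) (x j)) `^ delta)%:E.
  move=> Ms; have [[j Jj sE] smax] := Ms.
  have [kj gj] := kkP j Jj; rewrite -/(cell _ _ _) in gj.
  have dsE : dc s = cell Q (kk j) (x j) by rewrite -sE.
  have e0 := cube_content_gt0 (delta := delta) (dc s).
  have Gj : G s j by split=> //; rewrite dsE; exact: cell_refl.
  move=> [kjE|bad].
    apply: (@le_trans _ _ (\esum_(i in G s) (edge (cell Q (k i) (x i)) `^ delta)%:E)).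
      rewrite dsE kjE.
      exact: (esum_ge_term _ (fun i => (edge (cell Q (k i) (x i)) `^ delta)%:E)).
    rewrite -[leLHS]mul1e lee_wpmul2r ?lee_fin ?ler1n//.
    by apply: esum_ge0 => i _; rewrite lee_fin powR_ge0.
  have big : (t / 2 `^ delta * edge (dc s) `^ delta)%:E < choquet delta (dc s) w.
    apply: (@lt_le_trans _ _ (choquet delta (cell Q (kk j).+1 (x j)) w)).
      move/negP : bad; rewrite -ltNge; apply: le_lt_trans; rewrite lee_fin.
      rewrite dsE /= exprSr invfM mulrA [in leRHS]powRM ?invr_ge0//; last first.
        exact/ltW/dyadic_edge_gt0.
      by rewrite -powR_inv1// powRAC powR_inv1 ?powR_ge0// mulrAC mulrA.
    by rewrite dsE; apply: choquet_le_set; exact: cell_sub.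
  have fin : choquet delta (dc s) w \is a fin_num.
    by rewrite ge0_fin_numE ?choquet_ge0// dsE (le_lt_trans gj)// ltry.
  pose m := (fine (choquet delta (dc s) w) / edge (dc s) `^ delta)%R.
  have mE : choquet delta (dc s) w = (m * edge (dc s) `^ delta)%:E.
    by rewrite /m divfK ?gt_eqF// fineK.
  have tm : (t / 2 `^ delta < m)%R.
    by move: big; rewrite mE lte_fin ltr_pM2r.
  have p0 : (0 < 2 `^ delta :> R)%R by rewrite powR_gt0.
  have m0 : (0 < m)%R by apply: lt_trans tm; rewrite divr_gt0.
  rewrite muleC -lee_pdivrMr// -EFinM.
  apply: le_trans (half (dc s) m m0 mE) _.
  apply: content_cover => y [sy wy].
  have Ey : E y.
    split.
      rewrite -(cell0 _ (xE _ Jj).1); apply: (cell_sub 0 (kk j)) => //.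
      by rewrite -dsE.
    apply: le_lt_trans wy; rewrite lee_fin -mulrA ler_pM2l// mulrC; exact: ltW.
  have [i Ji yi] := cov y Ey.
  have [ki gi _] := kkP i Ji.
  exists i => //; split=> //.
  have sk : (s.1 <= kk i)%N.
    apply: (smax (kk i, dyadic_index Q (kk i) (x i)) y) => //; first by exists i.
    exact: cell_sub yi.
  apply/dyadic_cubeP; move/dyadic_cubeP : sy => <-.
  apply: (dyadic_index_coarsen _ _ _ _ _ (leq_trans sk ki)).
  by move/mem_cell : yi.
apply: (@le_trans _ _ (\esum_(s in M) (2%:E *
    \esum_(j in G s) (edge (cell Q (k j) (x j)) `^ delta)%:E))).
  exact: le_esum.
apply: le_trans (le_esumZl _ _ _ _ _) _ => // [s|].
  by apply: esum_ge0 => i _; rewrite lee_fin powR_ge0.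
rewrite lee_wpmul2l//; apply: esum_le_fiber => [j|s _ j []//|s s' j Ms Ms' [_ sj] [_ s'j]].
  by rewrite lee_fin powR_ge0.
exact: M_disj sj s'j.
Qed.

End DyadicCovers.

(** * Decay of the tails and the reverse Hölder inequality *)

Section ReverseHolder.
Context {R : realType} {n : nat} {delta : R}.
Context (delta_gt0 : (0 < delta)%R) (delta_len : (delta <= n%:R)%R).
Local Notation tail := (@tail R n delta).
Local Notation level := (@level R n delta).

(** If a child of a cube has mean above [t], then [w] exceeds
    [stop_ratio alpha * t] on half of the cube. *)
Definition stop_ratio (alpha : R) : R := (alpha / 2 `^ delta)%R.

(** The cost of passing to dyadic cubes, and then to cubes of controlled mean. *)
Definition cover_factor : R := (2 * (2 ^+ n * 2 `^ delta))%R.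

Definition level_growth (alpha : R) : R := (2 / stop_ratio alpha)%R.

(** The factor that tails lose from a level [t] to [level_growth alpha * t]. *)
Definition tail_loss (alpha : R) : R :=
  (1 + stop_ratio alpha / 2 / cover_factor)%R.

Lemma cover_factor_gt0 : (0 < cover_factor)%R.
Proof. by rewrite !mulr_gt0 ?exprn_gt0 ?powR_gt0. Qed.

Lemma stop_ratio_itv (alpha : R) :
  (0 < alpha <= 1)%R -> (0 < stop_ratio alpha <= 1)%R.
Proof.
move=> /andP[a0 a1]; have p0 : (0 < 2 `^ delta :> R)%R by rewrite powR_gt0.
rewrite divr_gt0//= ler_pdivrMr// mul1r (le_trans a1)//.
by rewrite -[leLHS](powRr0 2) ler_powR ?ler1n// ltW.
Qed.

Lemma level_growth_ge2 (alpha : R) : (0 < alpha <= 1)%R ->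
  (2 <= level_growth alpha)%R.
Proof.
by move=> /stop_ratio_itv/andP[b0 b1]; rewrite ler_pdivlMr// ler_piMr.
Qed.

Lemma tail_loss_gt1 (alpha : R) : (0 < alpha <= 1)%R -> (1 < tail_loss alpha)%R.
Proof.
move=> /stop_ratio_itv/andP[b0 b1].
by rewrite ltrDl; apply: divr_gt0 cover_factor_gt0; exact: divr_gt0.
Qed.

Context (Q : cube R n) (w : 'rV[R]_n -> \bar R) (alpha : R).
Context (alpha01 : (0 < alpha <= 1)%R)
  (half : half_above (delta := delta) alpha w).
Local Notation beta := (stop_ratio alpha).
Local Notation b := (level_growth alpha).
Local Notation d := (tail_loss alpha).

(** The means of [w] over the cubes of the improved cover are at most [t], so
    the tail at [t] costs at most [t] times the content of the cover. *)
Lemma tail_le_level (t : R) :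
  (0 < t)%R -> choquet delta Q w <= (t * edge Q `^ delta)%:E ->
  tail Q w t <= (cover_factor * t)%:E * level Q w (beta * t).
Proof.
move=> t0 Qt; have [a0 a1] := andP alpha01.
have /andP[b0 b1] := stop_ratio_itv alpha alpha01.
have c0 : (0 < cover_factor * t)%R by rewrite mulr_gt0// cover_factor_gt0.
rewrite -lee_pdivrMl//; apply: le_ereal_inf_tmp => _ [I [P [EP ->]]].
rewrite lee_pdivrMl//.
have [|T [J [k [x [xE cov sumJ]]]]] := dyadic_cover Q delta _ I P (ltW delta_gt0) _ EP.
  by move=> y [].
have [I' [cov' good sumI']] := stopping_cover Q delta alpha t w T J k x delta_gt0
  delta_len a0 half t0 Qt xE cov.
apply: (@le_trans _ _ (\esum_(s in I') choquet delta (dyadic_cube Q s.1 s.2) w)).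
  apply: tail_le_countable_cover; first exact: ltW.
  move=> y [Qy ty]; apply: cov'; split=> //; apply: le_lt_trans ty.
  by rewrite lee_fin ger_pMl.
apply: (@le_trans _ _ (\esum_(s in I')
    (t%:E * (edge (dyadic_cube Q s.1 s.2) `^ delta)%:E))).
  by apply: le_esum => s /good; rewrite EFinM.
apply: le_trans (le_esumZl _ _ _ _ _) _ => [|s|]; rewrite ?lee_fin ?powR_ge0 ?(ltW t0)//.
rewrite [(_ * t)%R]mulrC EFinM -muleA lee_wpmul2l ?lee_fin ?(ltW t0)//.
by apply: le_trans sumI' _; rewrite [in leRHS]EFinM -muleA lee_wpmul2l.
Qed.

(** Between the levels [beta / 2 * t] and [beta * t] the tail loses at least
    [beta / 2 * t * f (beta * t)], where [f] is the distribution function; by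
    the previous lemma this is a fixed fraction of the tail at [t]. *)
Lemma tail_contract (t : R) :
  (0 < t)%R -> choquet delta Q w <= (t * edge Q `^ delta)%:E ->
  d%:E * tail Q w t <= tail Q w (beta / 2 * t).
Proof.
move=> t0 Qt; have /andP[b0 b1] := stop_ratio_itv alpha alpha01.
have c0 := cover_factor_gt0.
have b2 : (beta / 2 * t <= beta * t)%R by rewrite ler_pM2r//; lra.
apply: le_trans (tail_split _ _ _ _ b2).
have k0 : (0 <= beta / 2 / cover_factor)%R.
  by apply: divr_ge0 (ltW c0); apply: divr_ge0 (ltW b0) _.
rewrite [in leLHS]EFinD ge0_muleDl ?lee_fin// mul1e addeC leeD//; last first.
  by apply: tail_nonincreasing; rewrite ger_pMl.
rewrite (_ : beta * t - _ = beta / 2 / cover_factor * (cover_factor * t))%R; last first.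
  by field; rewrite gt_eqF.
by rewrite [(_ * (cover_factor * t))%:E]EFinM -muleA lee_wpmul2l ?lee_fin// tail_le_level.
Qed.

Context (t : R) (t0 : (0 < t)%R)
  (Qt : choquet delta Q w <= (t * edge Q `^ delta)%:E).

Lemma tail_geometric (k : nat) :
  (d ^+ k)%:E * tail Q w (b ^+ k * t) <= (t * edge Q `^ delta)%:E.
Proof.
have /andP[beta0 beta1] := stop_ratio_itv alpha alpha01.
have b2 := level_growth_ge2 alpha alpha01; have d1 := tail_loss_gt1 alpha alpha01.
have [b0 d0] : (0 < b)%R /\ (0 < d)%R by split; lra.
elim: k => [|k IHk].
  rewrite !expr0 mul1e mul1r; apply: le_trans Qt; rewrite -tail0.
  by apply: tail_nonincreasing; exact: ltW.
apply: le_trans IHk; rewrite exprSr EFinM -muleA lee_wpmul2l//.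
  by rewrite lee_fin exprn_ge0// ltW.
rewrite (_ : b ^+ k * t = beta / 2 * (b ^+ k.+1 * t))%R; last first.
  by rewrite exprS /level_growth; field; rewrite gt_eqF.
apply: tail_contract; first by rewrite mulr_gt0 ?exprn_gt0.
apply: le_trans Qt _; rewrite lee_fin ler_pM2r ?cube_content_gt0//.
by rewrite ler_pMl// exprn_ege1//; lra.
Qed.

(** The decay of the tails passes to the distribution function because the
    levels at least double: the tail at [b ^ k * t] contains an interval of
    length at least [b ^ k * t] below the next level. *)
Lemma level_geometric (k : nat) :
  level Q w (b ^+ k.+1 * t) <= (edge Q `^ delta / (b * d) ^+ k)%:E.
Proof.
have b2 := level_growth_ge2 alpha alpha01; have d1 := tail_loss_gt1 alpha alpha01.
have [b0 d0] : (0 < b)%R /\ (0 < d)%R by split; lra.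
have bk0 : (0 < b ^+ k)%R by rewrite exprn_gt0.
have dk0 : (0 < d ^+ k)%R by rewrite exprn_gt0.
have step : (b ^+ k * t)%:E * level Q w (b ^+ k.+1 * t) <= tail Q w (b ^+ k * t).
  have bS : (b ^+ k * t + b ^+ k * t <= b ^+ k.+1 * t)%R.
    rewrite -mulrDl ler_pM2r// exprSr -[(b ^+ k + _)%R]mulr2n -mulr_natr.
    by rewrite ler_pM2l.
  have le : (b ^+ k * t <= b ^+ k.+1 * t)%R.
    by apply: le_trans bS; rewrite lerDl mulr_ge0// ltW.
  apply: le_trans (level_le_tail _ _ _ _ le); rewrite lee_wpmul2r ?level_ge0//.
  by rewrite lee_fin lerBrDl.
have c0 : (0 < d ^+ k * (b ^+ k * t))%R by rewrite !mulr_gt0.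
rewrite (_ : edge Q `^ delta / (b * d) ^+ k
    = (d ^+ k * (b ^+ k * t))^-1 * (t * edge Q `^ delta))%R; last first.
  by rewrite exprMn; field; rewrite !gt_eqF.
rewrite EFinM lee_pdivlMl//; apply: le_trans (tail_geometric k).
by rewrite EFinM -muleA lee_wpmul2l// lee_fin ltW.
Qed.

(** Summing over the layers between the levels [b ^ k * t]: the [k]-th layer
    contributes a multiple of [(b ^ gamma / d) ^ k], since the content of the
    level set beats the first power of the level by the factor [d ^ k]. *)
Lemma choquet_power_le (gamma : R) : (forall x, 0 <= w x) ->
  (0 < gamma)%R -> (b `^ gamma < d)%R ->
  choquet delta Q (fun x => w x `^ (1 + gamma)) <=
    (b * d * b `^ (1 + gamma) / (1 - b `^ gamma / d)
      * t `^ (1 + gamma) * edge Q `^ delta)%:E.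
Proof.
have := level_geometric; have := tail_loss_gt1 alpha alpha01.
have := level_growth_ge2 alpha alpha01.
move: (level_growth alpha) (tail_loss alpha) => b d b2 d1 decay w0 g0 bgd.
have [b0 d0] : (0 < b)%R /\ (0 < d)%R by split; lra.
have bg0 : (0 < b `^ gamma)%R by rewrite powR_gt0.
have g1 : (0 <= 1 + gamma)%R by lra.
have h0 := cube_content_gt0 (delta := delta) Q.
have bk0 k : (0 < b ^+ k)%R by rewrite exprn_gt0.
pose T k := ((b ^+ k.+1 * t) `^ (1 + gamma))%R.
(* Shifted by the factor [b * d], so that the term [k = 0] dominates the content
   of [Q] and the term [k + 1] is the bound for the level [b ^ (k + 1) * t]. *)
pose c k : \bar R := (b * d * (edge Q `^ delta / (b * d) ^+ k))%:E.
apply: (@le_trans _ _ (\sum_(k <oo) c k * (T k)%:E)).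
  apply: choquet_steps => [k|s||k]; first exact: powR_ge0.
  - have s0 : (0 <= `|s| + 1)%R by rewrite addr_ge0.
    have := archi_boundP (divr_ge0 s0 (ltW t0)).
    set k := Num.bound _ => sk; exists k.
    have tk : (`|s| + 1 < b ^+ k.+1 * t)%R.
      rewrite -ltr_pdivrMr//; apply: lt_le_trans sk _.
      apply: (@le_trans _ _ (2 ^+ k.+1)%R).
        rewrite -natrX ler_nat ltnW//.
        by apply: (leq_trans (ltn_expl k (ltnSn 1))); rewrite leq_exp2l.
      by rewrite lerXn2r// nnegrE; lra.
    apply: (@lt_le_trans _ _ (b ^+ k.+1 * t)%R); first by have := ler_norm s; lra.
    rewrite /T -[leLHS]powRr1; last by rewrite mulr_ge0// ltW.
    by rewrite ler_powR//; have := normr_ge0 s; lra.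
  - by rewrite content_cube// /c expr0 divr1 lee_fin ler_peMl ?(ltW h0)//; nra.
  - apply: (@le_trans _ _ (level Q w (b ^+ k.+1 * t))).
      apply: content_le => x [Qx Tx]; split=> //; rewrite ltNge; apply/negP => wx.
      move: Tx; apply/negP; rewrite -leNgt /T -poweR_EFin.
      apply: gt0_ler_poweR => //; rewrite in_itv/= leey andbT//.
      by rewrite lee_fin mulr_ge0// ltW.
    apply: le_trans (decay k) _.
    rewrite /c lee_fin exprS; rewrite le_eqVlt; apply/orP; left; apply/eqP.
    have : ((b * d) ^+ k != 0)%R by rewrite gt_eqF// exprn_gt0// mulr_gt0.
    by move: ((b * d) ^+ k)%R => e e0; field; rewrite e0 !gt_eqF.
set D := (b * d * b `^ (1 + gamma) * t `^ (1 + gamma) * edge Q `^ delta)%R.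
have -> : (fun m => \sum_(0 <= k < m) c k * (T k)%:E) =
    (fun m => \sum_(0 <= k < m) (D * (b `^ gamma / d) ^+ k)%:E).
  apply/funext => m; apply: eq_bigr => k _.
  rewrite /c /T -EFinM; congr EFin.
  rewrite powRM ?(ltW t0) ?(ltW (bk0 _))// exprS powRM ?(ltW b0) ?(ltW (bk0 _))//.
  have -> : ((b ^+ k) `^ (1 + gamma) = b ^+ k * (b `^ gamma) ^+ k)%R.
    rewrite -!powR_mulrn ?(ltW b0) ?(ltW bg0)// -powRrM mulrDr mulr1 powRD.
      by rewrite -powRrM [(gamma * _)%R]mulrC.
    by apply/implyP => _; rewrite gt_eqF.
  rewrite /D exprMn exprMn exprVn; field.
  by rewrite !expf_neq0 ?gt_eqF.
apply: le_trans (nneseries_geometric_le _ _ _ _) _ => //.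
- by rewrite !mulr_ge0 ?powR_ge0// ltW.
- by rewrite divr_gt0//= ltr_pdivrMr// mul1r.
rewrite lee_fin /D le_eqVlt; apply/orP; left; apply/eqP; field.
by rewrite !gt_eqF ?subr_gt0.
Qed.

End ReverseHolder.

Theorem theorem1p7 (R : realType) (n : nat) (delta p A : R)
    (delta_gt0 : (0 < delta)%R) (delta_len : (delta <= n%:R)%R)
    (p_ge1 : (1 <= p)%R) :
  exists K gamma : R, [/\ (0 < K)%R, (0 < gamma < 1)%R &
    forall w : 'rV[R]_n -> \bar R,
      Ap_weight delta p w -> Ap_const delta p w = A%:E ->
      forall Q : cube R n,
        (choquet delta Q (fun x => w x `^ (1 + gamma))
           / hausdorff_content delta Q) `^ (1 + gamma)^-1
        <= K%:E / hausdorff_content delta Q * choquet delta Q w].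
Proof.
have [alpha a01 half] :=
  Ap_weight_half_above R n delta p A delta_gt0 delta_len p_ge1.
set b := level_growth (delta := delta) alpha.
set d := tail_loss (n := n) (delta := delta) alpha.
have b2 : (2 <= b)%R := level_growth_ge2 delta_gt0 alpha a01.
have d1 : (1 < d)%R := tail_loss_gt1 delta_gt0 alpha a01.
have [|| gamma g01 bg] := exists_small_power b ((1 + d) / 2)%R; [lra|lra|].
have [g0 g1] := andP g01.
have bgd : (b `^ gamma < d)%R by lra.
have [b0 d0] : (0 < b)%R /\ (0 < d)%R by split; lra.
have g10 : (0 < 1 + gamma)%R by lra.
set K0 := (b * d * b `^ (1 + gamma) / (1 - b `^ gamma / d))%R.
have K0_gt0 : (0 < K0)%R.
  apply: divr_gt0; first by apply: mulr_gt0; [exact: mulr_gt0|exact: powR_gt0].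
  by rewrite subr_gt0 ltr_pdivrMr// mul1r.
set K := (K0 `^ (1 + gamma)^-1)%R.
have K_gt0 : (0 < K)%R by rewrite powR_gt0.
exists K, gamma; split=> // w wAp wA Q.
have [[w0 _ _] _] := wAp.
have h0 := cube_content_gt0 (delta := delta) Q.
rewrite content_cube// inver gt_eqF//.
set h := (edge Q `^ delta)%R in h0 *.
case wQ : (choquet delta Q w) (choquet_ge0 (delta := delta) Q w) => [y| |]//.
  rewrite lee_fin => y0.
  (* Levels [t] strictly above the mean of [w] are positive without any argument
     that the mean is; they tend to the mean with [e]. *)
  apply/lee_addgt0Pr => e e0.
  pose t := (y / h + e / K)%R.
  have t0 : (0 < t)%R by rewrite ltr_wpDl ?divr_gt0 ?divr_ge0 ?(ltW h0).
  have wt : choquet delta Q w <= (t * h)%:E.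
    by rewrite wQ lee_fin -ler_pdivrMr// lerDl divr_ge0// ltW.
  have wpow := choquet_power_le delta_gt0 delta_len Q w alpha a01
    (half w wAp wA) t t0 wt gamma w0 g0 bgd.
  apply: (@le_trans _ _ ((K0 * t `^ (1 + gamma))%:E `^ (1 + gamma)^-1)).
    apply: gt0_ler_poweR.
    - by rewrite invr_ge0 ltW.
    - rewrite in_itv/= leey andbT mule_ge0 ?choquet_ge0//.
      by rewrite lee_fin invr_ge0 ltW.
    - by rewrite in_itv/= leey andbT lee_fin mulr_ge0 ?powR_ge0 ?ltW.
    - by rewrite muleC lee_pdivrMl// muleC -EFinM; exact: wpow.
  rewrite poweR_EFin powRM ?powR_ge0 ?(ltW K0_gt0)// -/K -powRrM.
  rewrite divff ?gt_eqF// powRr1 ?(ltW t0)// -!EFinM -EFinD lee_fin.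
  rewrite le_eqVlt; apply/orP; left; apply/eqP; rewrite /t; field.
  by rewrite !gt_eqF.
by move=> _; rewrite -EFinM gt0_muley ?leey// lte_fin divr_gt0.
Qed.
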